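(* Let $\Gamma^1=(G,\sigma_1,\mu_1)$ be a $\gamma_1$-regular signed graph on $n_1$ vertices and $m_1$ edges, let $\theta$ be any $r$-orientation of the edges of $\Gamma^1$, and let $\Gamma^2=(H,\sigma_2,\mu_2)$ be an arbitrary signed graph on $n_2$ vertices. Let $\lambda_1(Q(\Gamma^1)),\dots,\lambda_{n_1}(Q(\Gamma^1))$ be the eigenvalues of $Q(\Gamma^1)$. If $\lambda$ is not a pole of $\Sigma_{Q(\Gamma^2)}(\lambda-\gamma_1)$, then $$f_{Q((\Gamma^1\boxdot\Gamma^2)_\theta)}(\lambda)=(\lambda-2-2n_2)^{m_1-n_1}\big(f_{Q(\Gamma^2)}(\lambda-\gamma_1)\big)^{n_1}\prod_{j=1}^{n_1}\Big(\lambda^2-(\gamma_1+2+2n_2)\lambda+2\gamma_1(n_2+1)-\big(1+(\lambda-\gamma_1)\Sigma_{Q(\Gamma^2)}(\lambda-\gamma_1)\big)\lambda_j(Q(\Gamma^1))\Big).$$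
   Context: A signed graph $\Gamma=(G,\sigma,\mu)$ has a finite simple graph $G$ with vertices $v_1,\dots,v_n$, signature $\sigma:E(G)\to\{\pm1\}$ and marking $\mu:V(G)\to\{\pm1\}$; $\mu(\Gamma)=(\mu(v_1),\dots,\mu(v_n))^T$. $A(\Gamma)$ has $(i,j)$ entry $\sigma(v_iv_j)$ if $v_i\sim v_j$ and $0$ otherwise; $D(\Gamma)$ is the diagonal matrix of (unsigned) degrees; $Q(\Gamma)=D(\Gamma)+A(\Gamma)$. $\gamma$-regular means all degrees equal $\gamma$. $f_M(\lambda)=\det(\lambda I-M)$. The signed $N$-coronal is the rational function $\Sigma_N(X)=\mu(\Gamma)^T(XI_n-N)^{-1}\mu(\Gamma)$. An $r$-orientation of $(G,\sigma)$ is a map $\theta:V(G)\times E(G)\to\{-1,0,1\}$ with $\theta(w,uv)=0$ for $w\notin\{u,v\}$, $\theta(u,uv)\in\{\pm1\}$ at endpoints, and $\theta(u,uv)\theta(v,uv)=\sigma(uv)$. The subdivision graph $S(\Gamma^1_\theta)$ is obtained by inserting a new vertex $v_e$ into each edge $e$ of $\Gamma^1$, the edge $v_iv_e$ having sign $\theta(v_i,e)$. With $V(\Gamma^1)=\{v_1,\dots,v_{n_1}\}$, the subdivision vertex neighbourhood corona $(\Gamma^1\boxdot\Gamma^2)_\theta$ is obtained from $S(\Gamma^1_\theta)$ and $n_1$ disjoint copies of $\Gamma^2$ by joining, for each $t$, every inserted vertex $v_e$ with $e$ incident to $v_t$ to every vertex $u$ of the $t$-th copy, with sign $\theta(v_t,e)\mu_2(u)$,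 where $\mu_2(u)$ is the marking of the corresponding vertex of $\Gamma^2$.
   Formalization: When m_1 < n_1 (so γ_1 is 0 or 1), the value λ = 2 + 2n_2 is excluded, because there the factor (λ-2-2n_2)^{m_1-n_1} would be a negative power of zero and the right side is undefined. *)

(* Defs.v *)
From HB Require Import structures.
From mathcomp Require Import all_boot all_order all_algebra.

Set Implicit Arguments.
Unset Strict Implicit.
Unset Printing Implicit Defensive.

Import Order.TTheory GRing.Theory Num.Theory.

Local Open Scope ring_scope.
Local Open Scope quotient_scope.

Definition is_sign (z : int) : bool := (z == 1) || (z == -1).

(* A finite simple graph on V with its signature. The sign of the edge uv is
   [sgn u v]; values of [sgn] at non-adjacent pairs are irrelevant. *)
Record signed_graph (V : finType) := SignedGraph {
  adj : rel V;
  sgn : V -> V -> int;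
  adj_sym : symmetric adj;
  adj_irr : irreflexive adj;
  sgn_sym : forall u v, adj u v -> sgn u v = sgn v u;
  sgn_sign : forall u v, adj u v -> is_sign (sgn u v)
}.

Record marked_signed_graph (V : finType) := MarkedSignedGraph {
  underlying :> signed_graph V;
  mark : V -> int;
  mark_sign : forall v, is_sign (mark v)
}.

Section SignedGraphs.
Variables (V : finType) (G : signed_graph V).

Definition edge : Type :=
  {e : {set V} | [exists u, exists v, adj G u v && (e == [set u; v])]}.

Definition ends (e : edge) : {set V} := sval e.

Definition deg (v : V) : nat := #|[set u | adj G v u]|.

Definition regular (gamma : nat) : Prop := forall v, deg v = gamma.

Record r_orientation := ROrientation {
  orient :> V -> edge -> int;
  orient_out : forall w e, w \notin ends e -> orient w e = 0;
  orient_end : forall u e, u \in ends e -> is_sign (orient u e);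
  orient_sgn : forall u v e, adj G u v -> ends e = [set u; v] ->
    orient u e * orient v e = sgn G u v
}.

(* The vertices v_1, ..., v_n are listed by [enum_val]. *)
Definition adjacency_mx (R : nzRingType) : 'M[R]_#|V| :=
  \matrix_(i, j) if adj G (enum_val i) (enum_val j)
                 then (sgn G (enum_val i) (enum_val j))%:~R else 0.

Definition degree_mx (R : nzRingType) : 'M[R]_#|V| :=
  diag_mx (\row_i (deg (enum_val i))%:R).

Definition Qmx (R : nzRingType) : 'M[R]_#|V| := degree_mx R + adjacency_mx R.

End SignedGraphs.

Definition mark_vec (V : finType) (G : marked_signed_graph V) (R : nzRingType) :
  'cV[R]_#|V| := \col_i (mark G (enum_val i))%:~R.

Section Subdivision.
Variables (V : finType) (G : signed_graph V) (theta : r_orientation G).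

Definition subdivision_adj (x y : V + edge G) : bool :=
  match x, y with
  | inl v, inr e | inr e, inl v => v \in ends e
  | _, _ => false
  end.

Definition subdivision_sgn (x y : V + edge G) : int :=
  match x, y with
  | inl v, inr e | inr e, inl v => theta v e
  | _, _ => 0
  end.

Fact subdivision_adj_sym : symmetric subdivision_adj.
Proof. by case=> [u|e] [v|f]. Qed.

Fact subdivision_adj_irr : irreflexive subdivision_adj.
Proof. by case. Qed.

Fact subdivision_sgn_sym x y :
  subdivision_adj x y -> subdivision_sgn x y = subdivision_sgn y x.
Proof. by case: x y => [u|e] [v|f]. Qed.

Fact subdivision_sgn_sign x y :
  subdivision_adj x y -> is_sign (subdivision_sgn x y).
Proof. by case: x y => [u|e] [v|f] //=; apply: orient_end. Qed.

Definition subdivision : signed_graph (V + edge G)%type :=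
  SignedGraph subdivision_adj_sym subdivision_adj_irr
              subdivision_sgn_sym subdivision_sgn_sign.

End Subdivision.

Fact is_signM a b : is_sign a -> is_sign b -> is_sign (a * b).
Proof. by move=> /orP[] /eqP-> /orP[] /eqP->. Qed.

(* [inr (t, u)] is the vertex u of the t-th copy of the second graph. The matrix
   Q does not involve a marking, so none is put on the corona. *)
Section Corona.
Variables (V1 V2 : finType) (G1 : signed_graph V1) (theta : r_orientation G1).
Variable G2 : marked_signed_graph V2.

Local Notation corona_vertex := ((V1 + edge G1) + V1 * V2)%type.

Definition sv_nbhd_corona_adj (x y : corona_vertex) : bool :=
  match x, y with
  | inl a, inl b => adj (subdivision theta) a b
  | inr (s, u), inr (t, v) => (s == t) && adj G2 u v
  | inl (inr e), inr (t, _) | inr (t, _), inl (inr e) => t \in ends e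
  | _, _ => false
  end.

Definition sv_nbhd_corona_sgn (x y : corona_vertex) : int :=
  match x, y with
  | inl a, inl b => sgn (subdivision theta) a b
  | inr (_, u), inr (_, v) => sgn G2 u v
  | inl (inr e), inr (t, u) | inr (t, u), inl (inr e) => theta t e * mark G2 u
  | _, _ => 0
  end.

Fact sv_nbhd_corona_adj_sym : symmetric sv_nbhd_corona_adj.
Proof.
by case=> [[a|e]|[s u]] [[b|f]|[t v]] //=; rewrite eq_sym adj_sym.
Qed.

Fact sv_nbhd_corona_adj_irr : irreflexive sv_nbhd_corona_adj.
Proof. by case=> [[a|e]|[s u]] //=; rewrite adj_irr andbF. Qed.

Fact sv_nbhd_corona_sgn_sym x y : sv_nbhd_corona_adj x y ->
  sv_nbhd_corona_sgn x y = sv_nbhd_corona_sgn y x.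
Proof.
by case: x y => [[a|e]|[s u]] [[b|f]|[t v]] //= /andP[_ /sgn_sym].
Qed.

Fact sv_nbhd_corona_sgn_sign x y : sv_nbhd_corona_adj x y ->
  is_sign (sv_nbhd_corona_sgn x y).
Proof.
case: x y => [[a|e]|[s u]] [[b|f]|[t v]] //=; try exact: orient_end.
- by move=> te; rewrite is_signM ?mark_sign ?orient_end.
- by move=> te; rewrite is_signM ?mark_sign ?orient_end.
- by case/andP=> _ /sgn_sign.
Qed.

Definition sv_nbhd_corona : signed_graph corona_vertex :=
  SignedGraph sv_nbhd_corona_adj_sym sv_nbhd_corona_adj_irr
              sv_nbhd_corona_sgn_sym sv_nbhd_corona_sgn_sign.

End Corona.

(* Rational functions in one variable over F are the elements of
   {fraction {poly F}}; poles and values are read off in lowest terms, so that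
   removable singularities are not poles. *)
Section RationalFunctions.
Variable F : fieldType.
Implicit Types (r : {fraction {poly F}}) (a : F).

Definition ratnum r : {poly F} :=
  \n_(repr r) %/ gcdp \n_(repr r) \d_(repr r).

Definition ratden r : {poly F} :=
  \d_(repr r) %/ gcdp \n_(repr r) \d_(repr r).

Definition pole r a : bool := root (ratden r) a.

Definition rateval r a : F := (ratnum r).[a] / (ratden r).[a].

Definition ratconst (c : F) : {fraction {poly F}} := tofrac c%:P.

Definition ratX : {fraction {poly F}} := tofrac 'X.

(* The rational function mu^T (X I - N)^{-1} mu. *)
Definition coronal n (mu : 'cV[F]_n) (N : 'M[F]_n) : {fraction {poly F}} :=
  ((map_mx ratconst mu)^T *m invmx (ratX%:M - map_mx ratconst N)
     *m map_mx ratconst mu) 0 0.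

End RationalFunctions.

Definition Qcoronal (F : fieldType) (V : finType) (G : marked_signed_graph V) :
  {fraction {poly F}} := coronal (mark_vec G F) (Qmx G F).

(* Main.v *)
Require Import Defs.
From HB Require Import structures.
(* [fingroup] comes first so that [repr] is the one of [generic_quotient]. *)
From mathcomp Require Import fingroup perm.
From mathcomp Require Import all_boot all_order all_algebra.
From mathcomp Require Import ring.

(** Put [x = lambda - gamma1] and [d = lambda - 2 - 2 n2], and let [B] be the
    signed vertex-edge incidence matrix of [theta], so that [B B^T = Q(Gamma1)].
    Listing the original vertices, the inserted vertices and the copies in this
    order, [lambda I - Q] is a 3 x 3 block matrix with diagonal blocks [x I],
    [d I] and [I (x) (x I - Q(Gamma2))].  Eliminating the copies turns [d I]
    into [d I - s B^T B], where [s] is the coronal at [x].  Adding [s B^T] times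
    the first block row to the second restores [d I] and multiplies the block
    [- B^T] by [1 + x s], so the Schur complement of [d I] is, up to powers of
    [d], [x d I - (1 + x s) Q(Gamma1)].  All this takes place over the field of
    rational functions in the indeterminate [x], where [x I - Q(Gamma2)] is
    invertible and [s] is the coronal itself; since [s] is the only fraction
    involved, the identity specializes to every point that is not a pole of
    [s]. *)

Set Implicit Arguments.
Unset Strict Implicit.
Unset Printing Implicit Defensive.

Import Order.TTheory GRing.Theory Num.Theory.

Local Open Scope ring_scope.

Definition kron_row (R : pzSemiRingType) m n k (A : 'M[R]_(m, n)) (v : 'rV_k) :
    'M_(m, \sum_(t < n) k) :=
  \mxrow_t (col t A *m v).

Lemma kron_rowE (R : pzSemiRingType) m n k (A : 'M[R]_(m, n)) (v : 'rV_k) i j :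
  kron_row A v i j = A i (tagnat.sig1 j) * v 0 (tagnat.sig2 j).
Proof. by rewrite !mxE big_ord1 mxE. Qed.

Lemma mxdiagE (V : nmodType) n k (B : 'I_n -> 'M[V]_k) i j :
  (\mxdiag_t B t) i j =
  if tagnat.sig1 i == tagnat.sig1 j
  then B (tagnat.sig1 i) (tagnat.sig2 i) (tagnat.sig2 j) else 0.
Proof. by rewrite mxE; case: eqP => _; rewrite ?conform_mx_id ?mxE. Qed.

Variant ord_add3_spec m n p : 'I_(m + n + p) -> Type :=
  | OrdAdd3First a : ord_add3_spec (lshift p (lshift n a))
  | OrdAdd3Second b : ord_add3_spec (lshift p (rshift m b))
  | OrdAdd3Third c : ord_add3_spec (rshift (m + n) c).

Lemma ord_add3P m n p (i : 'I_(m + n + p)) : ord_add3_spec i.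
Proof.
case: (split_ordP i) => [{}i ->|c ->]; last by constructor.
by case: (split_ordP i) => ? ->; constructor.
Qed.

Section BlockDeterminants.
Variable R : comNzRingType.

Lemma det_mxsub_bij m n (f : 'I_m -> 'I_n) (A : 'M[R]_n) :
  bijective f -> \det (mxsub f f A) = \det A.
Proof.
move=> fb; have mn : m = n by have := bij_eq_card fb; rewrite !card_ord.
case: _ / mn f A fb => {n} f A /bij_inj f_inj.
have -> : mxsub f f A = row_perm (perm f_inj) (col_perm (perm f_inj) A).
  by apply/matrixP => i j; rewrite !mxE !permE.
rewrite row_permE col_permE !det_mulmx mulrCA -det_mulmx.
by rewrite -perm_mxM mulgV perm_mx1 det1 mulr1.
Qed.

Lemma mxsub_scalar_inj m n (f : 'I_m -> 'I_n) (a : R) :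
  injective f -> mxsub f f a%:M = a%:M.
Proof. by move=> f_inj; apply/matrixP => i j; rewrite !mxE (inj_eq f_inj). Qed.

Lemma det_mxdiag n (p : 'I_n -> nat) (B : forall i, 'M[R]_(p i)) :
  \det (\mxdiag_i B i) = \prod_i \det (B i).
Proof.
elim: n p B => [|n IHn] p B.
  by move: (\mxdiag_i _); rewrite !big_ord0 => A; rewrite det_mx00.
rewrite mxdiag_recl; case: _ / mxsize_recl.
by rewrite castmx_id det_ublock IHn big_ord_recl.
Qed.

Lemma det_block_schur_dr m n (A : 'M[R]_m) (B : 'M_(m, n)) (D : 'M_n)
    (Y : 'M_(n, m)) :
  \det (block_mx A B (D *m Y) D) = \det (A - B *m Y) * \det D.
Proof.
have -> : block_mx A B (D *m Y) D =
    block_mx (A - B *m Y) B 0 D *m block_mx 1%:M 0 Y 1%:M.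
  by rewrite mulmx_block !mulmx1 !mulmx0 subrK !add0r.
by rewrite det_mulmx det_ublock det_lblock !det1 !mulr1.
Qed.

Lemma det_block_row_add m n (A : 'M[R]_m) (B : 'M_(m, n)) (C : 'M_(n, m))
    (D : 'M_n) (Y : 'M_(n, m)) :
  \det (block_mx A B (C + Y *m A) (D + Y *m B)) = \det (block_mx A B C D).
Proof.
have -> : block_mx A B (C + Y *m A) (D + Y *m B) =
    block_mx 1%:M 0 Y 1%:M *m block_mx A B C D.
  by rewrite mulmx_block !mul1mx !mul0mx !addr0 ![Y *m _ + _]addrC.
by rewrite det_mulmx det_lblock !det1 !mul1r.
Qed.

Lemma det_block_scalar_dr m n (A : 'M[R]_m) (B : 'M_(m, n)) (C : 'M_(n, m))
    (d : R) :
  d ^+ m * \det (block_mx A B C d%:M) = d ^+ n * \det (d *: A - B *m C).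
Proof.
have factorE : block_mx A B C d%:M *m block_mx d%:M 0 (- C) 1%:M =
    block_mx (d *: A - B *m C) B 0 d%:M.
  rewrite mulmx_block !mulmx1 !mulmx0 !add0r !mul_mx_scalar mul_scalar_mx.
  by rewrite mulmxN scalerN subrr.
have := congr1 determinant factorE.
rewrite det_mulmx det_lblock det_ublock det1 !det_scalar mulr1.
by rewrite mulrC => ->; rewrite mulrC.
Qed.

Lemma mul_mxdiag n (p : 'I_n -> nat) (A B : forall i, 'M[R]_(p i)) :
  \mxdiag_i A i *m \mxdiag_i B i = \mxdiag_i (A i *m B i).
Proof.
rewrite [X in _ *m X]/mxdiag mul_mxdiag_mxblock; apply/eq_mxblock => i j.
by case: eqVneq => [->|_]; rewrite ?conform_mx_id ?mulmx0.
Qed.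

Lemma kron_row_quad m n k (A : 'M[R]_(m, n)) (v : 'rV_k) (N : 'M_k) :
  kron_row A v *m \mxdiag_t N *m (kron_row A v)^T =
  (v *m N *m v^T) 0 0 *: (A *m A^T).
Proof.
have blockE t : col t A *m v *m N *m (col t A *m v)^T =
    (v *m N *m v^T) 0 0 *: (col t A *m row t A^T).
  rewrite trmx_mul tr_col -!mulmxA (mulmxA N) (mulmxA v).
  by rewrite [v *m _ in LHS]mx11_scalar mul_scalar_mx -scalemxAr.
rewrite mul_mxrow_mxdiag tr_mxrow mul_mxrow_mxcol.
under eq_bigr do rewrite blockE.
rewrite -scaler_sumr; congr (_ *: _).
apply/matrixP => i j; rewrite summxE mxE; apply: eq_bigr => t _.
by rewrite !mxE big_ord1 !mxE.
Qed.

End BlockDeterminants.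

Lemma det_corona_blocks (R : comUnitRingType) n m k (x d : R) (A : 'M[R]_(n, m))
    (v : 'rV_k) (N : 'M_k) (W := col_mx 0 (kron_row A^T v))
    (s := (v *m invmx N *m v^T) 0 0) :
  N \in unitmx ->
  d ^+ n * \det (block_mx (block_mx x%:M (- A) (- A^T) d%:M)
                          (- W) (- W^T) (\mxdiag_(t < n) N)) =
  d ^+ m * \det N ^+ n * \det ((x * d)%:M - (1 + x * s) *: (A *m A^T)).
Proof.
move=> Nu; have NVN : \mxdiag_(t < n) N *m \mxdiag_t invmx N = 1%:M.
  by rewrite mul_mxdiag; under eq_mxdiag do rewrite mulmxV //; rewrite mxdiagZ.
have WNW : W *m \mxdiag_t invmx N *m W^T = block_mx 0 0 0 (s *: (A^T *m A)).
  rewrite tr_col_mx trmx0 mul_col_mx mul_col_row !mul0mx mulmx0.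
  by rewrite kron_row_quad trmxK.
rewrite -[- W^T]mul1mx -NVN -mulmxA det_block_schur_dr.
rewrite !mulmxN mulNmx opprK mulmxA WNW opp_block_mx add_block_mx !oppr0 !addr0.
rewrite det_mxdiag prodr_const card_ord mulrA [RHS]mulrAC; congr (_ * _).
have := det_block_row_add x%:M (- A) (- (1 + x * s) *: A^T) d%:M (s *: A^T).
rewrite mul_mx_scalar mulmxN -scalemxAl scalerA -scalerDl.
rewrite opprD addrNK scaleN1r => ->; rewrite det_block_scalar_dr.
by rewrite scale_scalar_mx mulNmx -scalemxAr -opprD scaleNr opprK [d * x]mulrC.
Qed.

Lemma horner_char_poly (R S : comNzRingType) (f : {rmorphism R -> S}) n
    (N : 'M[R]_n) (a : S) :
  (map_poly f (char_poly N)).[a] = \det (a%:M - map_mx f N).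
Proof.
rewrite map_char_poly -horner_evalE -det_map_mx; congr (\det _).
apply/matrixP => i j; rewrite !mxE /= /horner_eval !hornerE.
by rewrite hornerMn hornerX.
Qed.

Lemma det_scalar_subZ (F : fieldType) n (N : 'M[F]_n) (e : 'I_n -> F) a b :
  char_poly N = \prod_j ('X - (e j)%:P) ->
  \det (a%:M - b *: N) = \prod_j (a - b * e j).
Proof.
move=> charN; have [->|b0] := eqVneq b 0.
  rewrite scale0r subr0 det_scalar.
  by under eq_bigr do rewrite mul0r subr0; rewrite prodr_const card_ord.
have -> : a%:M - b *: N = b *: ((a / b)%:M - N).
  by rewrite scalerBr scale_scalar_mx mulrCA divff ?mulr1.
have := horner_char_poly idfun N (a / b).
rewrite map_mx_id // map_poly_id // charN detZ => <-.
rewrite horner_prod -[in b ^+ n](card_ord n) -prodr_const -big_split /=.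
by apply: eq_bigr => j _; rewrite !hornerE mulrBr mulrCA divff ?mulr1.
Qed.

Lemma pi_mul_denom (R : idomainType) (x : {ratio R}) :
  \pi_({fraction R})%qT x * tofrac \d_x = tofrac \n_x.
Proof.
unlock tofrac; rewrite -[LHS]FracField.pi_mul; apply/eqmodP.
case: x => x /= x2_neq0; rewrite FracField.equivfE /FracField.mulf /=.
by rewrite !numden_Ratio ?mulr1 ?oner_neq0 //= mulrC.
Qed.

Section RationalFunctions.
Variable F : fieldType.

Lemma mul_ratden (r : {fraction {poly F}}) :
  r * tofrac (ratden r) = tofrac (ratnum r).
Proof.
set n := \n_(repr r); set d := \d_(repr r).
have gcd0 : gcdp n d != 0 by rewrite gcdp_eq0 negb_and denom_ratioP orbT.
apply: (@mulIf _ (tofrac (gcdp n d))); first by rewrite tofrac_eq0.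
rewrite -mulrA -!tofracM !divpK ?dvdp_gcdl ?dvdp_gcdr //.
by have := pi_mul_denom (repr r); rewrite reprK.
Qed.

Lemma horner_rateval_prod (r : {fraction {poly F}}) a n (A B : {poly F})
    (u v : 'I_n -> {poly F}) :
  ~~ pole r a ->
  tofrac A = tofrac B * \prod_j (tofrac (u j) - tofrac (v j) * r) ->
  A.[a] = B.[a] * \prod_j ((u j).[a] - (v j).[a] * rateval r a).
Proof.
rewrite /pole rootE => den_a fracE.
have prod_mulr_exp (R : comNzRingType) (e : R) (w : 'I_n -> R) :
    \prod_j w j * e ^+ n = \prod_j (w j * e).
  by rewrite big_split /= prodr_const card_ord.
have clearedE :
    A * ratden r ^+ n = B * \prod_j (u j * ratden r - v j * ratnum r).
  apply/eqP; rewrite -tofrac_eq !tofracM fracE -mulrA tofracXn prod_mulr_exp.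
  rewrite rmorph_prod; apply/eqP; congr (_ * _); apply: eq_bigr => j _.
  by rewrite mulrBl -mulrA mul_ratden rmorphB !rmorphM.
apply: (mulIf (expf_neq0 n den_a)).
have /(congr1 (horner^~ a)) := clearedE.
rewrite !hornerM horner_exp horner_prod -mulrA prod_mulr_exp => ->.
congr (_ * _); apply: eq_bigr => j _.
by rewrite hornerD hornerN !hornerM mulrBl -mulrA divfK.
Qed.

End RationalFunctions.

(* The subtractions are truncated: one of the two exponents is 0. *)
Lemma expr_subn_cancel (R : idomainType) m n (x y z : R) :
  x != 0 -> x ^+ n * y = x ^+ m * z -> x ^+ (n - m) * y = x ^+ (m - n) * z.
Proof.
move=> x0 xyz; have [nm|/ltnW mn] := leqP n m.
  rewrite (eqnP nm) mul1r; apply: (mulfI (expf_neq0 n x0)).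
  by rewrite xyz mulrA -exprD subnKC.
rewrite (eqnP mn) mul1r; apply: (mulfI (expf_neq0 m x0)).
by rewrite -xyz mulrA -exprD subnKC.
Qed.

Lemma exprz_subn_cancel (F : fieldType) m n (x y z : F) :
  ((m < n)%N -> x != 0) ->
  x ^+ (n - m) * y = x ^+ (m - n) * z -> y = x ^ (m%:Z - n%:Z) * z.
Proof.
have [nm _|mn /(_ isT) x0] := leqP n m.
  by rewrite (eqnP nm) mul1r subzn.
rewrite (eqnP (ltnW mn)) mul1r => <-.
by rewrite -opprB subzn 1?ltnW // -invr_expz mulKf ?expf_neq0.
Qed.

HB.instance Definition _ (F : fieldType) :=
  GRing.RMorphism.copy (@ratconst F) (@FracField.tofrac {poly F} \o polyC).

Lemma det_tofrac_char_poly (F : fieldType) n (N : 'M[F]_n) (q : {poly F}) :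
  \det ((tofrac q)%:M - map_mx (@ratconst F) N) = tofrac (char_poly N \Po q).
Proof.
by rewrite -horner_char_poly /comp_poly -horner_map -map_poly_comp.
Qed.

Lemma sum_mem_card (T : finType) (A : {set T}) : (\sum_x (x \in A) = #|A|)%N.
Proof. by rewrite -sum1_card [RHS]big_mkcond. Qed.

Section SignedGraphs.
Variables (V : finType) (G : signed_graph V).

Definition signed_adj u v : int := if adj G u v then sgn G u v else 0.

Definition Qentry u v : int := (deg G u)%:R *+ (u == v) + signed_adj u v.

Lemma signed_adj_sym u v : signed_adj u v = signed_adj v u.
Proof. by rewrite /signed_adj adj_sym; case: ifP => // /sgn_sym. Qed.

Lemma Qentry_sym u v : Qentry u v = Qentry v u.
Proof. by rewrite /Qentry signed_adj_sym eq_sym; case: eqP => // ->. Qed.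

Lemma QmxE (R : nzRingType) i j :
  Qmx G R i j = (Qentry (enum_val i) (enum_val j))%:~R.
Proof.
rewrite !mxE /Qentry (inj_eq enum_val_inj) rmorphD rmorphMn /= rmorph_nat.
by congr (_ + _); rewrite /signed_adj; case: ifP.
Qed.

Lemma map_Qmx (R S : nzRingType) (f : {rmorphism R -> S}) :
  map_mx f (Qmx G R) = Qmx G S.
Proof. by apply/matrixP => i j; rewrite mxE !QmxE rmorph_int. Qed.

Lemma degree_mx_regular (R : nzRingType) gamma :
  regular G gamma -> degree_mx G R = gamma%:R%:M.
Proof. by move=> regG; apply/matrixP => i j; rewrite !mxE regG. Qed.

Lemma sum_adj_deg u : (\sum_v adj G u v = deg G u)%N.
Proof. by rewrite /deg -sum_mem_card; under [RHS]eq_bigr do rewrite inE. Qed.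

Lemma endsP (e : edge G) : exists u v, adj G u v /\ ends e = [set u; v].
Proof.
by case: e => e /= /existsP[u /existsP[v /andP[uv /eqP->]]]; exists u, v.
Qed.

Lemma adj_neq u v : adj G u v -> u != v.
Proof. by apply: contraTneq => ->; rewrite adj_irr. Qed.

Lemma card_ends (e : edge G) : #|ends e| = 2%N.
Proof. by have [u [v [/adj_neq uv ->]]] := endsP e; rewrite cards2 uv. Qed.

Lemma edge_of_adj u v : adj G u v -> exists e : edge G, ends e = [set u; v].
Proof.
move=> uv.
have uvP : [exists a, exists b, adj G a b && ([set u; v] == [set a; b])].
  by apply/existsP; exists u; apply/existsP; exists v; rewrite uv eqxx.
by exists (Sub [set u; v] uvP).
Qed.

Lemma ends_inj : injective (@ends V G).
Proof. exact: val_inj. Qed.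

Lemma ends_pair u v (e : edge G) : u != v -> u \in ends e -> v \in ends e ->
  adj G u v /\ ends e = [set u; v].
Proof.
have [a [b [ab ->]]] := endsP e; rewrite !inE => uv ue ve.
case/orP: ue ve uv => /eqP-> /orP[] /eqP->; rewrite ?eqxx // => _.
by rewrite adj_sym setUC.
Qed.

Lemma sum_mem_ends_deg v : (\sum_(e : edge G) (v \in ends e) = deg G v)%N.
Proof.
have pair_inj : {in [set u | adj G v u] &, injective (fun u => [set v; u])}.
  move=> a b; rewrite !inE => /adj_neq va _ /setP/(_ a).
  by rewrite !inE eqxx orbT eq_sym (negPf va) => /esym/eqP.
transitivity #|[set e : edge G | v \in ends e]|.
  by rewrite -sum_mem_card; under [RHS]eq_bigr do rewrite inE.
rewrite -(card_imset _ ends_inj) /deg -(card_in_imset pair_inj).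
apply: eq_card => A; apply/imsetP/imsetP => -[].
  move=> e; rewrite inE => ve ->.
  have [a [b [ab ends_e]]] := endsP e; move: ve; rewrite ends_e !inE.
  case/orP=> /eqP->; first by exists b; rewrite ?inE.
  by exists a; rewrite ?inE 1?adj_sym // setUC.
move=> u; rewrite inE => /edge_of_adj[e ends_e] ->.
by exists e; rewrite ?inE ends_e // !inE eqxx.
Qed.

Variable theta : r_orientation G.

Lemma orient_sqr v e : theta v e * theta v e = (v \in ends e)%:R.
Proof.
have [ve|/orient_out->] := boolP (v \in ends e); last by rewrite mul0r.
by case/orP: (orient_end theta ve) => /eqP->.
Qed.

Lemma orient_mem_ends v e c :
  (if v \in ends e then theta v e * c else 0) = theta v e * c.
Proof. by case: ifPn => // /orient_out->; rewrite mul0r. Qed.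

Lemma orient_mul_neq u v e : u != v ->
  theta u e * theta v e = if ends e == [set u; v] then signed_adj u v else 0.
Proof.
move=> uv; case: eqP => [ends_e|notuv].
  have [ue ve] : u \in ends e /\ v \in ends e by rewrite ends_e !inE !eqxx orbT.
  have [auv _] := ends_pair uv ue ve.
  by rewrite (orient_sgn _ auv ends_e) /signed_adj auv.
have [ue|/orient_out->] := boolP (u \in ends e); last by rewrite mul0r.
have [ve|/orient_out->] := boolP (v \in ends e); last by rewrite mulr0.
by have [_ /notuv] := ends_pair uv ue ve.
Qed.

Lemma sum_orient u v : \sum_e theta u e * theta v e = Qentry u v.
Proof.
rewrite /Qentry; have [<-|uv] := eqVneq u v.
  rewrite /signed_adj adj_irr addr0 -sum_mem_ends_deg natr_sum.
  by apply: eq_bigr => e _; apply: orient_sqr.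
under eq_bigr do rewrite orient_mul_neq //.
rewrite -big_mkcond add0r /=; have [auv|nuv] := boolP (adj G u v).
  have [e ends_e] := edge_of_adj auv.
  by rewrite (big_pred1 e) // => f; rewrite -ends_e (inj_eq ends_inj).
by rewrite /signed_adj (negPf nuv) big1.
Qed.

Definition incidence_mx (R : nzRingType) : 'M[R]_(#|V|, #|{: edge G}|) :=
  \matrix_(i, e) (theta (enum_val i) (enum_val e))%:~R.

Lemma incidence_mxMtr (R : nzRingType) :
  incidence_mx R *m (incidence_mx R)^T = Qmx G R.
Proof.
apply/matrixP => i j; rewrite QmxE -sum_orient [RHS]rmorph_sum mxE.
rewrite [RHS](reindex _ (onW_bij _ (@enum_val_bij _))) /=.
by apply: eq_bigr => e _; rewrite !mxE rmorphM.
Qed.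

End SignedGraphs.

Lemma map_mark_vec (R S : nzRingType) (f : {rmorphism R -> S}) (V : finType)
    (G : marked_signed_graph V) :
  map_mx f (mark_vec G R) = mark_vec G S.
Proof. by apply/matrixP => i j; rewrite !mxE rmorph_int. Qed.

Section Corona.
Variables (V1 V2 : finType) (G1 : signed_graph V1) (theta : r_orientation G1).
Variable G2 : marked_signed_graph V2.
Local Notation n1 := #|V1|.
Local Notation m1 := #|{: edge G1}|.
Local Notation n2 := #|V2|.
Local Notation G := (sv_nbhd_corona theta G2).

Lemma deg_corona_vertex v : deg G (inl (inl v)) = deg G1 v.
Proof.
rewrite -sum_adj_deg !big_sumType /= big1 // add0n sum_mem_ends_deg.
by rewrite big1 ?addn0 // => -[].
Qed.

Lemma deg_corona_edge e : deg G (inl (inr e)) = (2 + 2 * n2)%N.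
Proof.
rewrite -sum_adj_deg !big_sumType /= sum_mem_card card_ends.
rewrite [X in (_ + X + _)%N]big1 // addn0; congr (_ + _)%N.
have -> : (2 * n2 = \sum_(t in V1) (t \in ends e) * n2)%N.
  by rewrite -big_distrl /= sum_mem_card card_ends.
under [RHS]eq_bigr do rewrite mulnC -sum_nat_const.
by rewrite pair_bigA; apply: eq_bigr => -[].
Qed.

Lemma deg_corona_copy t u : deg G (inr (t, u)) = (deg G1 t + deg G2 u)%N.
Proof.
rewrite -sum_adj_deg !big_sumType /= big1 // add0n sum_mem_ends_deg.
congr (_ + _)%N; rewrite -sum_adj_deg.
transitivity (\sum_s \sum_v ((t == s) && adj G2 u v))%N.
  by rewrite pair_bigA; apply: eq_bigr => -[].
rewrite (bigD1 t) //= [X in (_ + X)%N]big1 ?addn0; last first.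
  by move=> s /negPf; rewrite eq_sym => ->; rewrite big1.
by apply: eq_bigr => v _; rewrite eqxx.
Qed.

Lemma Qcorona_vertex_vertex u v :
  Qentry G (inl (inl u)) (inl (inl v)) = (deg G1 u)%:R *+ (u == v).
Proof. by rewrite /Qentry /signed_adj /= deg_corona_vertex addr0. Qed.

Lemma Qcorona_vertex_edge v e :
  Qentry G (inl (inl v)) (inl (inr e)) = theta v e.
Proof.
by rewrite /Qentry /signed_adj /= add0r -[theta v e]mulr1 orient_mem_ends.
Qed.

Lemma Qcorona_edge_edge e f :
  Qentry G (inl (inr e)) (inl (inr f)) = (2 + 2 * n2)%:R *+ (e == f).
Proof. by rewrite /Qentry /signed_adj /= deg_corona_edge addr0. Qed.

Lemma Qcorona_vertex_copy v t u : Qentry G (inl (inl v)) (inr (t, u)) = 0.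
Proof. by rewrite /Qentry /signed_adj /= addr0. Qed.

Lemma Qcorona_edge_copy e t u :
  Qentry G (inl (inr e)) (inr (t, u)) = theta t e * mark G2 u.
Proof. by rewrite /Qentry /signed_adj /= add0r orient_mem_ends. Qed.

Lemma Qcorona_copy_copy s t u v : Qentry G (inr (s, u)) (inr (t, v)) =
  if s == t then (deg G1 s)%:R *+ (u == v) + Qentry G2 u v else 0.
Proof.
rewrite /Qentry /signed_adj /= deg_corona_copy (inj_eq inr_inj) xpair_eqE.
by case: eqP => //= _; rewrite natrD mulrnDl addrA.
Qed.

Definition corona_enum (i : 'I_(n1 + m1 + \sum_(t < n1) n2)) :
    V1 + edge G1 + V1 * V2 :=
  match split i with
  | inl j => match split j with
             | inl a => inl (inl (enum_val a))
             | inr e => inl (inr (enum_val e))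
             end
  | inr k => inr (enum_val (tagnat.sig1 k), enum_val (tagnat.sig2 k))
  end.

Lemma corona_enumE :
  (forall a, corona_enum (lshift _ (lshift _ a)) = inl (inl (enum_val a))) *
  (forall e, corona_enum (lshift _ (rshift _ e)) = inl (inr (enum_val e))) *
  (forall k, corona_enum (rshift _ k) =
     inr (enum_val (tagnat.sig1 k), enum_val (tagnat.sig2 k))).
Proof.
split; [split=> [a|e]|move=> k]; rewrite /corona_enum.
- by rewrite !(unsplitK (inl _)).
- by rewrite (unsplitK (inl _)) (unsplitK (inr _)).
- by rewrite (unsplitK (inr _)).
Qed.

Lemma corona_enum_inj : injective corona_enum.
Proof.
move=> i j; case: (ord_add3P i) => [a|e|k]; case: (ord_add3P j) => [b|f|l];
  rewrite !corona_enumE //.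
- by case=> /enum_val_inj->.
- by case=> /enum_val_inj->.
case=> /enum_val_inj sig1E /enum_val_inj sig2E.
pose pos (t : 'I_n1) (u : 'I_n2) := @tagnat.Rank n1 (fun=> n2) t u.
have posK k' : pos (tagnat.sig1 k') (tagnat.sig2 k') = k' := tagnat.sig2K k'.
by congr (rshift _ _); rewrite -[k]posK sig1E sig2E posK.
Qed.

Lemma corona_enum_rank_bij : bijective (enum_rank \o corona_enum).
Proof.
apply: inj_card_bij; first exact: inj_comp enum_rank_inj corona_enum_inj.
by rewrite !card_ord !card_sum card_prod sum_nat_const card_ord.
Qed.

Lemma Qmx_corona_blocks (R : nzRingType) (B := incidence_mx theta R)
    (W := col_mx 0 (kron_row B^T (mark_vec G2 R)^T)) :
  mxsub (enum_rank \o corona_enum) (enum_rank \o corona_enum) (Qmx G R) =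
  block_mx (block_mx (degree_mx G1 R) B B^T (2 + 2 * n2)%:R%:M) W W^T
    (\mxdiag_t ((deg G1 (enum_val t))%:R%:M + Qmx G2 R)).
Proof.
apply/matrixP => i j; rewrite mxE QmxE !enum_rankK.
case: (ord_add3P i) => [a|e|k]; case: (ord_add3P j) => [b|f|l];
  rewrite !corona_enumE
    ?block_mxEul ?block_mxEur ?block_mxEdl ?block_mxEdr
    ?block_mxEul ?block_mxEur ?block_mxEdl ?block_mxEdr.
- rewrite Qcorona_vertex_vertex (inj_eq enum_val_inj) !mxE.
  by rewrite rmorphMn /= rmorph_nat.
- by rewrite Qcorona_vertex_edge mxE.
- by rewrite Qcorona_vertex_copy col_mxEu mxE.
- by rewrite Qentry_sym Qcorona_vertex_edge !mxE.
- rewrite Qcorona_edge_edge (inj_eq enum_val_inj) mxE.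
  by rewrite rmorphMn /= rmorph_nat.
- by rewrite Qcorona_edge_copy col_mxEd kron_rowE !mxE rmorphM.
- by rewrite Qentry_sym Qcorona_vertex_copy mxE col_mxEu mxE.
- by rewrite Qentry_sym Qcorona_edge_copy mxE col_mxEd kron_rowE !mxE rmorphM.
rewrite Qcorona_copy_copy mxdiagE (inj_eq enum_val_inj).
case: eqP => // _; rewrite mxE QmxE mxE (inj_eq enum_val_inj).
by rewrite rmorphD rmorphMn /= rmorph_nat.
Qed.

End Corona.

Lemma det_sub_Qmx_corona (R : comUnitRingType) (V1 V2 : finType)
    (G1 : signed_graph V1) (theta : r_orientation G1)
    (G2 : marked_signed_graph V2) gamma (a : R)
    (x := a - gamma%:R) (d := a - (2 + 2 * #|V2|)%:R) (mu := mark_vec G2 R)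
    (s := (mu^T *m invmx (x%:M - Qmx G2 R) *m mu) 0 0) :
  regular G1 gamma -> x%:M - Qmx G2 R \in unitmx ->
  d ^+ #|V1| * \det (a%:M - Qmx (sv_nbhd_corona theta G2) R) =
  d ^+ #|{: edge G1}| * \det (x%:M - Qmx G2 R) ^+ #|V1| *
    \det ((x * d)%:M - (1 + x * s) *: Qmx G1 R).
Proof.
move=> reg1 Nu; pose f := enum_rank \o @corona_enum V1 V2 G1.
have f_bij : bijective f := corona_enum_rank_bij V2 G1.
have <- := det_mxsub_bij (a%:M - Qmx (sv_nbhd_corona theta G2) R) f_bij.
rewrite linearB /= mxsub_scalar_inj; last exact: bij_inj f_bij.
rewrite Qmx_corona_blocks !scalar_mx_block opp_block_mx add_block_mx.
rewrite opp_block_mx add_block_mx !add0r -(mxdiagZ a) -mxdiagB.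
under eq_mxdiag do rewrite reg1 opprD addrA -raddfB.
rewrite (degree_mx_regular _ reg1) -!raddfB det_corona_blocks //.
by rewrite trmxK incidence_mxMtr.
Qed.

Lemma tofrac_char_poly_corona (F : fieldType) (V1 V2 : finType)
    (G1 : signed_graph V1) (theta : r_orientation G1)
    (G2 : marked_signed_graph V2) gamma (e : 'I_#|V1| -> F)
    (D := 'X + gamma%:R%:P - (2 + 2 * #|V2|)%:R%:P : {poly F})
    (m := #|{: edge G1}|) (n := #|V1|) :
  regular G1 gamma -> char_poly (Qmx G1 F) = \prod_j ('X - (e j)%:P) ->
  tofrac (D ^+ (n - m) *
    (char_poly (Qmx (sv_nbhd_corona theta G2) F) \Po ('X + gamma%:R%:P))) =
  tofrac (D ^+ (m - n) * char_poly (Qmx G2 F) ^+ n) *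
    \prod_j (tofrac ('X * D - (e j)%:P) -
              tofrac ('X * (e j)%:P) * Qcoronal F G2).
Proof.
move=> reg1 eigP; pose a := tofrac ('X + gamma%:R%:P : {poly F}).
have tofracD_neq0 : tofrac D != 0.
  have -> : D = 'X - ((2 + 2 * #|V2|)%:R - gamma%:R)%:P.
    by rewrite raddfB opprB addrA.
  by rewrite tofrac_eq0 polyXsubC_eq0.
have a_sub_gamma : a - gamma%:R = ratX F.
  by rewrite /a tofracD !rmorph_nat addrK.
have a_sub_deg : a - (2 + 2 * #|V2|)%:R = tofrac D.
  by rewrite /a /D tofracB !rmorph_nat.
have := det_sub_Qmx_corona theta (G2 := G2) (a := a) reg1.
rewrite a_sub_gamma a_sub_deg.
rewrite -!(map_Qmx _ (@ratconst F)) -(map_mark_vec (@ratconst F)).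
rewrite !det_tofrac_char_poly comp_polyXr -[(_ *m _) 0 0]/(Qcoronal F G2).
rewrite (det_scalar_subZ (e := @ratconst F \o e)); last first.
  rewrite -map_char_poly eigP rmorph_prod.
  by apply: eq_bigr => j _; rewrite /= map_polyXsubC.
rewrite unitmxE det_tofrac_char_poly comp_polyXr unitfE tofrac_eq0.
rewrite monic_neq0 ?char_poly_monic // -mulrA.
move=> /(_ isT)/(expr_subn_cancel tofracD_neq0).
rewrite !rmorphM !rmorphXn /= => ->; rewrite -mulrA; congr (_ * (_ * _)).
apply: eq_bigr => j _; rewrite [tofrac (_ - (e j)%:P)]tofracB !tofracM.
by rewrite mulrDl mul1r opprD addrA mulrAC.
Qed.

Theorem theorem5p9 (C : numClosedFieldType) (V1 V2 : finType)
    (n1 m1 n2 gamma1 : nat)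
    (Gamma1 : marked_signed_graph V1) (Gamma2 : marked_signed_graph V2)
    (theta : r_orientation Gamma1)
    (card_V1 : #|V1| = n1) (card_E1 : #|{: edge Gamma1}| = m1)
    (card_V2 : #|V2| = n2)
    (regular1 : regular Gamma1 gamma1)
    (eig : 'I_n1 -> C)
    (eigP : char_poly (Qmx Gamma1 C) = \prod_(j < n1) ('X - (eig j)%:P))
    (lambda : C)
    (not_pole : ~~ pole (Qcoronal C Gamma2) (lambda - gamma1%:R))
    (* the integer power below must not be a negative power of 0 *)
    (pow_def : (m1 < n1)%N -> lambda - 2 - 2 * n2%:R != 0) :
  (char_poly (Qmx (sv_nbhd_corona theta Gamma2) C)).[lambda] =
  (lambda - 2 - 2 * n2%:R) ^ (m1%:Z - n1%:Z) *
  (char_poly (Qmx Gamma2 C)).[lambda - gamma1%:R] ^+ n1 *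
  \prod_(j < n1)
    (lambda ^+ 2 - (gamma1%:R + 2 + 2 * n2%:R) * lambda
     + 2 * gamma1%:R * (n2%:R + 1)
     - (1 + (lambda - gamma1%:R) *
            rateval (Qcoronal C Gamma2) (lambda - gamma1%:R)) * eig j).
Proof.
subst n1 m1 n2.
have := tofrac_char_poly_corona theta Gamma2 regular1 eigP.
set D := 'X + _ - _ => /(horner_rateval_prod not_pole).
have D_lambda : D.[lambda - gamma1%:R] = lambda - 2 - 2 * #|V2|%:R.
  rewrite hornerD hornerN hornerD hornerX !hornerC subrK.
  by rewrite natrD natrM opprD addrA.
rewrite !hornerM !horner_exp D_lambda horner_comp hornerD hornerX hornerC subrK.
rewrite -!mulrA => /(exprz_subn_cancel pow_def)->; congr (_ * (_ * _)).
apply: eq_bigr => j _.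
rewrite hornerD hornerN !hornerM hornerX hornerC D_lambda.
by ring.
Qed.
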